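(* Let $\Lambda\subset\mathbb{R}^N$ be a self-similar arc associated to contractive similitudes $S_1,\dots,S_\ell$, of Hausdorff dimension $s>1$, with vertices $z_0,\dots,z_\ell$, and let $f(x)=H^s([z_0,x])$ for $x\in\Lambda$. Then $f$ has the property $$|f(x)-f(y)|=o(|x-y|),\quad x,y\in\Lambda$$ (that is, for each $\varepsilon>0$ there is $\delta>0$ such that $|f(x)-f(y)|\le\varepsilon|x-y|$ whenever $x,y\in\Lambda$ and $|x-y|<\delta$) if and only if $\Lambda$ satisfies Condition $W_p$ for every $p=1,\dots,\ell-1$.
   Context: A contractive similitude with ratio $r\in(0,1)$ is a map $S:\mathbb{R}^N\to\mathbb{R}^N$ with $|S(x)-S(y)|=r|x-y|$ for all $x,y$. Given contractive similitudes $S_1,\dots,S_\ell$, the associated self-similar set is the unique nonempty compact set $\Lambda$ with $\Lambda=\bigcup_{i=1}^{\ell}S_i(\Lambda)$. It is called a self-similar arc if $\Lambda$ is an arc (a homeomorphic image of $[0,1]$) and (1) $S_i(\Lambda)\cap S_j(\Lambda)$ is a singleton whenever $|i-j|=1$; (2) $S_i(\Lambda)\cap S_j(\Lambda)=\emptyset$ whenever $|i-j|>1$. Order: let $h:[0,1]\to\Lambda$ be a homeomorphism with $h(0)\in S_1(\Lambda)$. Write $x\prec y$ if $h^{-1}(x)<h^{-1}(y)$ (and $x\preceq y$ for the non-strict order), and $[x,y]=\{z\in\Lambda: x\preceq z\preceq y\}$. There are points $z_0\prec z_1\prec\dots\prec z_\ell$ (the vertices) such that $S_j(\Lambda)=[z_{j-1},z_j]$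 for $j=1,\dots,\ell$. $H^s$ denotes $s$-dimensional Hausdorff measure. For $1\le p\le\ell-1$, $\Lambda$ satisfies Condition $W_p$ if for each $\varepsilon>0$ there is $\mu_p>0$ such that $|f(x)-f(y)|\le\varepsilon|x-y|$ whenever $z_{p-1}\preceq x\preceq z_p\preceq y\preceq z_{p+1}$ and $|x-y|<\mu_p$. *)

(* Defs.v *)
From HB Require Import structures.
From mathcomp Require Import all_boot all_order all_algebra.
From mathcomp Require Import all_classical all_reals all_analysis.

Set Implicit Arguments.
Unset Strict Implicit.
Unset Printing Implicit Defensive.

Import Order.TTheory GRing.Theory Num.Theory.
Import numFieldNormedType.Exports.

Local Open Scope classical_set_scope.
Local Open Scope ring_scope.

(* The library norm on 'rV[R]_N is the sup norm, so the Euclidean distance is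
   defined here; it induces the same topology, which is the library one. *)
Definition eucl_dist (R : realType) (N : nat) (x y : 'rV[R]_N) : R :=
  Num.sqrt (\sum_(i < N) (x ord0 i - y ord0 i) ^+ 2).

(* Equal to -oo on the empty set. *)
Definition eucl_diam (R : realType) (N : nat) (A : set 'rV[R]_N) : \bar R :=
  ereal_sup [set (eucl_dist x y)%:E | x in A & y in A].

(* |U|^s; the empty set contributes 0 even when s = 0. *)
Definition hausdorff_gauge (R : realType) (N : nat) (s : R)
    (U : set 'rV[R]_N) : \bar R :=
  if U == set0 then 0%E else (eucl_diam U `^ s)%E.

Definition hausdorff_content (R : realType) (N : nat) (s delta : R)
    (A : set 'rV[R]_N) : \bar R :=
  ereal_inf
    [set (\sum_(0 <= i <oo) hausdorff_gauge s (U i))%E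
    | U in [set U : nat -> set 'rV[R]_N |
             A `<=` \bigcup_i U i /\
             forall i, (eucl_diam (U i) <= delta%:E)%E]].

Definition hausdorff_measure (R : realType) (N : nat) (s : R)
    (A : set 'rV[R]_N) : \bar R :=
  ereal_sup [set hausdorff_content s delta A | delta in [set d : R | 0 < d]].

Definition hausdorff_dim (R : realType) (N : nat) (A : set 'rV[R]_N) : \bar R :=
  ereal_inf [set t%:E | t in [set t : R | 0 <= t /\ hausdorff_measure t A = 0%E]].

Definition contractive_similitude (R : realType) (N : nat)
    (T : 'rV[R]_N -> 'rV[R]_N) : Prop :=
  exists r : R, [/\ 0 < r, r < 1 &
    forall x y, eucl_dist (T x) (T y) = r * eucl_dist x y].

(* The maps are S 1, ..., S l; other values of S : nat -> _ are irrelevant. *)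
Definition self_similar_set (R : realType) (N l : nat)
    (S : nat -> 'rV[R]_N -> 'rV[R]_N) (L : set 'rV[R]_N) : Prop :=
  [/\ forall i, (1 <= i <= l)%N -> contractive_similitude (S i),
      L !=set0, compact L &
      L = \bigcup_(i in [set i | (1 <= i <= l)%N]) (S i @` L)].

Definition homeomorphism_on (T U : topologicalType) (A : set T) (B : set U)
    (h : T -> U) (g : U -> T) : Prop :=
  [/\ {within A, continuous h}, {within B, continuous g},
      (forall t, A t -> B (h t) /\ g (h t) = t) &
      (forall u, B u -> A (g u) /\ h (g u) = u)].

Definition is_arc (R : realType) (N : nat) (L : set 'rV[R]_N) : Prop :=
  exists (h : R -> 'rV[R]_N) (g : 'rV[R]_N -> R),
    homeomorphism_on (`[0, 1] : set R) L h g.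

Definition self_similar_arc (R : realType) (N l : nat)
    (S : nat -> 'rV[R]_N -> 'rV[R]_N) (L : set 'rV[R]_N) : Prop :=
  [/\ self_similar_set l S L, is_arc L,
      forall i j, (1 <= i <= l)%N -> (1 <= j <= l)%N ->
        `|i%:Z - j%:Z|%N = 1%N ->
        exists z, (S i @` L) `&` (S j @` L) = [set z] &
      forall i j, (1 <= i <= l)%N -> (1 <= j <= l)%N ->
        (1 < `|i%:Z - j%:Z|%N)%N ->
        (S i @` L) `&` (S j @` L) = set0].

(* [x, y] for the order of the arc L given by g, the inverse of its
   parametrization: x precedes y when g x < g y. *)
Definition arc_itv (R : realType) (N : nat) (L : set 'rV[R]_N)
    (g : 'rV[R]_N -> R) (x y : 'rV[R]_N) : set 'rV[R]_N :=
  [set z | [/\ L z, g x <= g z & g z <= g y]].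

(* The vertices are z 0, ..., z l. *)
Definition arc_vertices (R : realType) (N l : nat)
    (S : nat -> 'rV[R]_N -> 'rV[R]_N) (L : set 'rV[R]_N)
    (g : 'rV[R]_N -> R) (z : nat -> 'rV[R]_N) : Prop :=
  [/\ forall j, (j <= l)%N -> L (z j),
      forall j, (1 <= j <= l)%N -> g (z j.-1) < g (z j) &
      forall j, (1 <= j <= l)%N -> S j @` L = arc_itv L g (z j.-1) (z j)].

(* Extended-real valued, as H^s is; if f x = f y = +oo then the difference is
   -oo in the library, so the bounds below fail instead of holding vacuously. *)
Definition arc_measure (R : realType) (N : nat) (s : R) (L : set 'rV[R]_N)
    (g : 'rV[R]_N -> R) (z0 x : 'rV[R]_N) : \bar R :=
  hausdorff_measure s (arc_itv L g z0 x).

Definition little_o_dist (R : realType) (N : nat) (L : set 'rV[R]_N)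
    (f : 'rV[R]_N -> \bar R) : Prop :=
  forall eps : R, 0 < eps -> exists2 delta : R, 0 < delta &
    forall x y, L x -> L y -> eucl_dist x y < delta ->
      (`|f x - f y| <= (eps * eucl_dist x y)%:E)%E.

Definition condition_W (R : realType) (N : nat) (L : set 'rV[R]_N)
    (g : 'rV[R]_N -> R) (z : nat -> 'rV[R]_N) (f : 'rV[R]_N -> \bar R)
    (p : nat) : Prop :=
  forall eps : R, 0 < eps -> exists2 mu : R, 0 < mu &
    forall x y, L x -> L y ->
      g (z p.-1) <= g x -> g x <= g (z p) ->
      g (z p) <= g y -> g y <= g (z p.+1) ->
      eucl_dist x y < mu ->
      (`|f x - f y| <= (eps * eucl_dist x y)%:E)%E.

(* Main.v *)
Require Import Defs.
From HB Require Import structures.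
From mathcomp Require Import all_boot all_order all_algebra.
From mathcomp Require Import all_classical all_reals all_analysis.
From mathcomp Require Import ring lra zify.

(* Sufficiency: given distinct x, y in L, undo the similitudes of the smallest
   cylinder containing both, so that x', y' lie in no common first-level piece,
   |x - y| = k |x' - y'| and H^s[x, y] <= k^s H^s[x', y'], with 0 < k <= 1.  If
   |x' - y'| is small, then x', y' lie in adjacent pieces and Condition W applies
   to them; as k^s <= k, the bound passes to x, y.  Otherwise |x' - y'| is bounded
   below, so k = O(|x - y|) and k^s H^s(L) = k^(s-1) O(|x - y|) = o(|x - y|).

   The finiteness of H^s(L) follows from Condition W_1 itself, and the identity
   |f x - f y| = H^s[x, y] holds because H^s is additive on sets at positive
   distance and has no atoms on L. *)

Set Implicit Arguments.
Unset Strict Implicit.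
Unset Printing Implicit Defensive.

Import Order.TTheory GRing.Theory Num.Theory.
Import numFieldNormedType.Exports.

Local Open Scope classical_set_scope.
Local Open Scope ring_scope.

(** * Euclidean distance and its comparison with the sup norm *)

Section EuclideanDistance.
Variables (R : realType) (N : nat).
Implicit Types x y : 'rV[R]_N.

Lemma eucl_dist_ge0 x y : 0 <= eucl_dist x y.
Proof. exact: sqrtr_ge0. Qed.

Lemma eucl_distxx x : eucl_dist x x = 0.
Proof. by rewrite /eucl_dist big1 ?sqrtr0// => i _; rewrite subrr expr0n. Qed.

Lemma eucl_dist_sym x y : eucl_dist x y = eucl_dist y x.
Proof.
by rewrite /eucl_dist; congr Num.sqrt; apply: eq_bigr => i _; rewrite -sqrrN opprB.
Qed.

Lemma eucl_dist_coord x y (i : 'I_N) : `|x ord0 i - y ord0 i| <= eucl_dist x y.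
Proof.
rewrite -sqrtr_sqr /eucl_dist ler_wsqrtr// (bigD1 i)//= lerDl.
by apply: sumr_ge0 => j _; exact: sqr_ge0.
Qed.

Lemma eucl_dist_eq0 x y : eucl_dist x y = 0 -> x = y.
Proof.
move=> d0; apply/rowP => i; apply/eqP; rewrite -subr_eq0 -normr_le0 -d0.
exact: eucl_dist_coord.
Qed.

Lemma eucl_dist_gt0 x y : x <> y -> 0 < eucl_dist x y.
Proof.
move=> xy; rewrite lt_neqAle eucl_dist_ge0 andbT eq_sym.
by apply/eqP => /eucl_dist_eq0.
Qed.

Lemma norm_le_eucl_dist x y : `|x - y| <= eucl_dist x y.
Proof.
rewrite [`|_|]mx_normrE; apply/bigmax_leP; split => [|[i j] _].
  exact: eucl_dist_ge0.
by rewrite !mxE !ord1 eucl_dist_coord.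
Qed.

Lemma eucl_dist_le_norm x y : eucl_dist x y <= Num.sqrt N%:R * `|x - y|.
Proof.
rewrite -[`|x - y|]ger0_norm// -sqrtr_sqr -sqrtrM// ler_wsqrtr//.
rewrite mulr_natl -[X in _ <= _ *+ X]card_ord -sumr_const.
apply: ler_sum => i _; rewrite -real_normK ?num_real//.
rewrite lerXn2r ?nnegrE// [`|x - y|]mx_normrE.
rewrite (le_trans _ (le_bigmax _ _ (ord0, i)))//= !mxE//.
Qed.

End EuclideanDistance.

(** * Hausdorff contents and measures: subadditivity, separated sets, scaling *)

Section HausdorffMeasure.
Variables (R : realType) (N : nat) (s : R).
Implicit Types (A B U : set 'rV[R]_N) (d : R).

Lemma eucl_diam_le U (d : \bar R) :
  (forall x y, U x -> U y -> ((eucl_dist x y)%:E <= d)%E) ->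
  (eucl_diam U <= d)%E.
Proof. by move=> Ud; apply: ge_ereal_sup => _ [x Ux [y Uy <-]]; exact: Ud. Qed.

Lemma eucl_dist_le_diam U x y : U x -> U y ->
  ((eucl_dist x y)%:E <= eucl_diam U)%E.
Proof. by move=> Ux Uy; apply: ereal_sup_ubound; exists x => //; exists y. Qed.

Lemma eucl_diam_ge0 U : U !=set0 -> (0 <= eucl_diam U)%E.
Proof.
by move=> [x Ux]; have := eucl_dist_le_diam Ux Ux; rewrite eucl_distxx.
Qed.

Lemma hausdorff_gauge_ge0 U : (0 <= hausdorff_gauge s U)%E.
Proof. by rewrite /hausdorff_gauge; case: ifPn => // _; exact: poweR_ge0. Qed.

Lemma hausdorff_gauge0 : hausdorff_gauge s (@set0 'rV[R]_N) = 0%E.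
Proof. by rewrite /hausdorff_gauge eqxx. Qed.

Lemma eucl_diam0 d : (eucl_diam (@set0 'rV[R]_N) <= d%:E)%E.
Proof. exact: eucl_diam_le. Qed.

Lemma hausdorff_content_ge0 d A : (0 <= hausdorff_content s d A)%E.
Proof.
apply: le_ereal_inf_tmp => _ [U _ <-].
by apply: nneseries_ge0 => i _ _; exact: hausdorff_gauge_ge0.
Qed.

Lemma hausdorff_content_le_cover d A (U : nat -> set 'rV[R]_N) :
  A `<=` \bigcup_i U i -> (forall i, (eucl_diam (U i) <= d%:E)%E) ->
  (hausdorff_content s d A <= \sum_(0 <= i <oo) hausdorff_gauge s (U i))%E.
Proof. by move=> AU Ud; apply: ereal_inf_lbound; exists U. Qed.

Lemma le_hausdorff_content d A B : A `<=` B ->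
  (hausdorff_content s d A <= hausdorff_content s d B)%E.
Proof.
move=> AB; apply: le_ereal_inf_tmp => _ [U [BU Ud] <-].
by apply: hausdorff_content_le_cover => //; exact: subset_trans BU.
Qed.

Lemma hausdorff_content_anti d d' A : d' <= d ->
  (hausdorff_content s d A <= hausdorff_content s d' A)%E.
Proof.
move=> dd; apply: le_ereal_inf_tmp => _ [U [AU Ud] <-].
apply: hausdorff_content_le_cover => // i.
by rewrite (le_trans (Ud i))// lee_fin.
Qed.

(** Covers of [A] and [B] are interleaved into one cover of the union. Infinite values are set aside
    first, so that the infima can be reached by subtracting finite quantities. *)
Lemma hausdorff_contentU d A B :
  (hausdorff_content s d (A `|` B) <=
   hausdorff_content s d A + hausdorff_content s d B)%E.
Proof.
have [->|cA] := eqVneq (hausdorff_content s d A) +oo%E.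
  by rewrite addye ?leey// gt_eqF// (lt_le_trans _ (hausdorff_content_ge0 _ _)).
rewrite -leeBlDl ?ge0_fin_numE ?hausdorff_content_ge0 ?ltey//.
apply: le_ereal_inf_tmp => _ [V [BV Vd] <-].
rewrite leeBlDl ?ge0_fin_numE ?hausdorff_content_ge0 ?ltey//.
have V0 : (0 <= \sum_(0 <= i <oo) hausdorff_gauge s (V i))%E.
  by apply: nneseries_ge0 => *; exact: hausdorff_gauge_ge0.
have [->|cV] := eqVneq (\sum_(0 <= i <oo) hausdorff_gauge s (V i))%E +oo%E.
  by rewrite addey ?leey// gt_eqF// (lt_le_trans _ (hausdorff_content_ge0 _ _)).
rewrite -leeBlDr ?ge0_fin_numE ?ltey//.
apply: le_ereal_inf_tmp => _ [U [AU Ud] <-].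
rewrite leeBlDr ?ge0_fin_numE ?ltey//.
pose W i := if odd i then V i./2 else U i./2.
apply: (@le_trans _ _ (\sum_(0 <= i <oo) hausdorff_gauge s (W i))%E).
  apply: hausdorff_content_le_cover => [x [/AU|/BV] [i _ xi]|i].
  - by exists i.*2 => //; rewrite /W odd_double doubleK.
  - by exists i.*2.+1 => //; rewrite /W /= odd_double uphalf_double.
  - by rewrite /W; case: odd.
apply: lime_le; first by apply: is_cvg_nneseries => *; exact: hausdorff_gauge_ge0.
apply: nearW => n.
(* Even indices carry [U] and odd ones [V], so the first [n] terms contain [uphalf n] sets of [U]
   and [n./2] sets of [V]. *)
have -> : (\sum_(0 <= i < n) hausdorff_gauge s (W i) =
    \sum_(0 <= i < uphalf n) hausdorff_gauge s (U i) +
    \sum_(0 <= i < n./2) hausdorff_gauge s (V i))%E.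
  elim: n => [|n IH]; first by rewrite !big_geq// adde0.
  rewrite big_nat_recr//= IH /W uphalf_half.
  case: ifPn => /= _; rewrite ?add1n ?add0n !big_nat_recr//=.
    exact: esym (addeA _ _ _).
  exact: addeAC.
by apply: leeD; apply: nneseries_lim_ge => *; exact: hausdorff_gauge_ge0.
Qed.

(** A set of diameter at most [d] cannot meet both [A] and [B], so every cover of the union splits
    into a cover of each. *)
Lemma hausdorff_content_separated d A B :
  (forall a b, A a -> B b -> d < eucl_dist a b) ->
  (hausdorff_content s d A + hausdorff_content s d B <=
   hausdorff_content s d (A `|` B))%E.
Proof.
move=> sepAB; apply: le_ereal_inf_tmp => _ [W [ABW Wd] <-].
(* Sets that miss [C] are replaced by the empty set, whose gauge is 0, which keeps the indexing of
   the cover. *)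
pose cut (C : set 'rV[R]_N) i :=
  if pselect (W i `&` C !=set0) then W i else set0.
have cutP C : C `<=` A `|` B -> (hausdorff_content s d C <=
    \sum_(0 <= i <oo) hausdorff_gauge s (cut C i))%E.
  move=> CAB; apply: hausdorff_content_le_cover => [x Cx|i]; last first.
    by rewrite /cut; case: pselect => ? /=; [exact: Wd|exact: eucl_diam0].
  have [i _ Wix] := ABW _ (CAB _ Cx); exists i => //.
  by rewrite /cut; case: pselect => //= -[]; exists x.
apply: (le_trans (leeD (cutP _ (@subsetUl _ A B)) (cutP _ (@subsetUr _ A B)))).
rewrite -nneseriesD; try by move=> *; exact: hausdorff_gauge_ge0.
apply: lee_nneseries => i _; first by rewrite adde_ge0 ?hausdorff_gauge_ge0.
rewrite /cut.
case: pselect => [[a [Wa Aa]]|na]; case: pselect => [[b [Wb Bb]]|nb] /=.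
- have := le_trans (eucl_dist_le_diam Wa Wb) (Wd i).
  by rewrite lee_fin leNgt sepAB.
- by rewrite hausdorff_gauge0 adde0.
- by rewrite hausdorff_gauge0 add0e.
- by rewrite hausdorff_gauge0 adde0 hausdorff_gauge_ge0.
Qed.

Lemma hausdorff_content_le_measure d A : 0 < d ->
  (hausdorff_content s d A <= hausdorff_measure s A)%E.
Proof. by move=> d0; apply: ereal_sup_ubound; exists d. Qed.

Lemma hausdorff_measure_ge0 A : (0 <= hausdorff_measure s A)%E.
Proof.
apply: le_trans (hausdorff_content_le_measure A ltr01).
exact: hausdorff_content_ge0.
Qed.

Lemma le_hausdorff_measure A B : A `<=` B ->
  (hausdorff_measure s A <= hausdorff_measure s B)%E.
Proof.
move=> AB; apply: ge_ereal_sup => _ [d d0 <-].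
apply: le_trans (hausdorff_content_le_measure B d0).
exact: le_hausdorff_content.
Qed.

Lemma hausdorff_measureU A B :
  (hausdorff_measure s (A `|` B) <=
   hausdorff_measure s A + hausdorff_measure s B)%E.
Proof.
apply: ge_ereal_sup => _ [d d0 <-].
apply: (le_trans (hausdorff_contentU d A B)).
by apply: leeD; exact: hausdorff_content_le_measure.
Qed.

Lemma hausdorff_measure_separated e A B : 0 < e ->
  (forall a b, A a -> B b -> e <= eucl_dist a b) ->
  (hausdorff_measure s A + hausdorff_measure s B <=
   hausdorff_measure s (A `|` B))%E.
Proof.
move=> e0 sepAB; set HU := hausdorff_measure s (A `|` B).
have main d d' : 0 < d -> 0 < d' ->
    (hausdorff_content s d A + hausdorff_content s d' B <= HU)%E.
  (* Contents grow as the scale shrinks, so one scale below [d] and [d'] serves both; [e / 2] makes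
     the separation strict. *)
  move=> d0 d'0; pose m := Num.min (e / 2) (Num.min d d').
  have m0 : 0 < m by rewrite !lt_min d0 d'0 divr_gt0.
  apply: le_trans (hausdorff_content_le_measure _ m0).
  apply: le_trans (hausdorff_content_separated _) => [|a b Aa Bb].
    by apply: leeD; apply: hausdorff_content_anti; rewrite !ge_min lexx ?orbT.
  rewrite (lt_le_trans _ (sepAB _ _ Aa Bb))// gt_min; apply/orP; left; lra.
have [->|HUy] := eqVneq HU +oo%E; first exact: leey.
have HA : hausdorff_measure s A \is a fin_num.
  rewrite ge0_fin_numE ?hausdorff_measure_ge0// ltey.
  apply: contra_neq HUy => HAy; apply/eqP; rewrite -leye_eq -HAy.
  by apply: le_hausdorff_measure; exact: subsetUl.
rewrite -leeBrDl//; apply: ge_ereal_sup => _ [d' d'0 <-].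
rewrite leeBrDl// -leeBrDr; last first.
  rewrite ge0_fin_numE ?hausdorff_content_ge0//.
  apply: le_lt_trans (hausdorff_content_le_measure _ d'0) _.
  apply: (@le_lt_trans _ _ HU); last by rewrite ltey.
  by apply: le_hausdorff_measure; exact: subsetUr.
apply: ge_ereal_sup => _ [d d0 <-]; rewrite leeBrDr ?main//.
rewrite ge0_fin_numE ?hausdorff_content_ge0//.
apply: le_lt_trans (hausdorff_content_le_measure _ d'0) _.
apply: (@le_lt_trans _ _ HU); last by rewrite ltey.
by apply: le_hausdorff_measure; exact: subsetUr.
Qed.

(** A cover of [u @] D[is carried to]v @[D] through the common index set. Comparing two parametrized
    families makes the lemma apply to a similitude and, without constructing an inverse map, to
    undoing one. *)
Lemma hausdorff_measure_scale (I : Type) (D : set I) (u v : I -> 'rV[R]_N)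
    (c : R) : 0 <= s -> 0 < c ->
  (forall i j, D i -> D j ->
     eucl_dist (v i) (v j) <= c * eucl_dist (u i) (u j)) ->
  (hausdorff_measure s (v @` D) <= (c `^ s)%:E * hausdorff_measure s (u @` D))%E.
Proof.
move=> s0 c0 uv.
have cs0 : 0 < c `^ s by rewrite powR_gt0.
apply: ge_ereal_sup => _ [d d0 <-].
have dc0 : 0 < d / c by rewrite divr_gt0.
apply: le_trans (lee_wpmul2l _ (hausdorff_content_le_measure _ dc0)); last first.
  by rewrite lee_fin ltW.
rewrite -lee_pdivrMl//; apply: le_ereal_inf_tmp => _ [U [uU Ud] <-].
rewrite lee_pdivrMl//.
pose V k := v @` (D `&` u @^-1` U k).
have diamV k : (eucl_diam (V k) <= c%:E * eucl_diam (U k))%E.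
  apply: eucl_diam_le => _ _ [i [Di Ui] <-] [j [Dj Uj] <-].
  apply: (@le_trans _ _ (c * eucl_dist (u i) (u j))%:E).
    by rewrite lee_fin uv.
  rewrite EFinM; apply: lee_wpmul2l; first by rewrite lee_fin ltW.
  exact: eucl_dist_le_diam.
apply: (@le_trans _ _ (\sum_(0 <= k <oo) hausdorff_gauge s (V k))%E).
  apply: hausdorff_content_le_cover => [_ [i Di <-]|k].
    have [k _ Uk] : (\bigcup_k U k) (u i) by apply: uU; exists i.
    by exists k => //; exists i.
  apply: (le_trans (diamV k)).
  apply: (@le_trans _ _ (c%:E * (d / c)%:E)%E).
    by apply: lee_wpmul2l => //; rewrite lee_fin ltW.
  by rewrite -EFinM mulrC divfK// gt_eqF.
rewrite -nneseriesZl; last by move=> *; exact: hausdorff_gauge_ge0.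
apply: lee_nneseries => [k _ _|k _]; first exact: hausdorff_gauge_ge0.
(* [V k] may be empty while [U k] is not; if [V k] is nonempty, so is [U k], and both gauges are
   powers of diameters. *)
rewrite {1}/hausdorff_gauge; case: ifPn => [_|/set0P V0].
  by rewrite mule_ge0 ?hausdorff_gauge_ge0// lee_fin ltW.
have U0 : U k !=set0 by case: V0 => _ [i [_ Ui] _]; exists (u i).
rewrite /hausdorff_gauge ifF; last by apply/negbTE/set0P.
rewrite -poweR_EFin -poweRM ?eucl_diam_ge0 ?lee_fin//; last exact: ltW.
apply: gt0_ler_poweR => //; rewrite in_itv/= leey andbT.
- exact: eucl_diam_ge0.
- by rewrite mule_ge0 ?eucl_diam_ge0// lee_fin ltW.
Qed.

End HausdorffMeasure.

(** * Uniform continuity on compact sets and monotone self-maps of an arc *)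

Section ArcTopology.
Variables (R : realType) (N : nat).
Implicit Types (L : set 'rV[R]_N) (g : 'rV[R]_N -> R).

(** Heine-Cantor for the Euclidean distance, from the near-covering form of compactness. It turns a
    gap between values of the arc parameter into a positive distance. *)
Lemma eucl_unif_continuous L g : compact L -> {within L, continuous g} ->
  forall e, 0 < e -> exists2 d, 0 < d &
    forall x y, L x -> L y -> eucl_dist x y < d -> `|g x - g y| < e.
Proof.
move=> /compact_near_coveringP cL /subspace_continuousP cg e e0.
pose P (d : R) x := L x -> forall y, L y -> eucl_dist x y < d -> `|g x - g y| < e.
have : \forall d \near 0^'+, L `<=` P d.
  apply: cL => x Lx.
  have e2 : 0 < e / 2 by rewrite divr_gt0.
  have /cvgrPdist_lt/(_ _ e2) := cg x Lx.
  rewrite near_withinE => /nbhs_ballP[r /= r0 rP].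
  exists (ball x (r / 2), [set d | d < r / 2]).
    split => /=; first by apply: nbhsx_ballx; rewrite divr_gt0.
    by apply: nbhs_right_lt; rewrite divr_gt0.
  move=> [x' d] /= []; rewrite mx_norm_ball /ball_ /= => xx' dr Lx' y Ly x'y.
  have xy : ball x r y.
    rewrite mx_norm_ball /ball_ /= (splitr r) -(subrKA x').
    rewrite (le_lt_trans (ler_normD _ _))//.
    by rewrite ltrD// (le_lt_trans (norm_le_eucl_dist _ _))// (lt_trans x'y).
  have xx'r : ball x r x'.
    by rewrite mx_norm_ball /ball_ /= (lt_trans xx')// ltr_pdivrMr// ltr_pMr// ltr1n.
  have h1 := rP _ xx'r Lx'; have h2 := rP _ xy Ly.
  rewrite (splitr e) -(subrKA (g x)) (le_lt_trans (ler_normD _ _))// ltrD//.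
  by rewrite distrC.
move=> nearP; have [d /= [d0 dP]] : exists d : R, 0 < d /\ (L `<=` P d).
  near (0 : R)^'+ => d; exists d; split; first by near: d; exact: nbhs_right_gt.
  by near: d.
by exists d => // x y Lx; exact: dP.
Unshelve. all: by end_near. Qed.

Lemma eucl_lipschitz_continuous (T : 'rV[R]_N -> 'rV[R]_N) (c : R) : 0 <= c ->
  (forall x y, eucl_dist (T x) (T y) <= c * eucl_dist x y) -> continuous T.
Proof.
move=> c0 Tc x; apply/(@cvgrPdist_lt _ _ _ (nbhs x)) => e e0.
(* The added 1 keeps the divisor positive when [c] or [N] is 0. *)
have C0 : 0 < c * Num.sqrt N%:R + 1 by rewrite ltr_wpDl// mulr_ge0.
apply/nbhs_ballP; exists (e / (c * Num.sqrt N%:R + 1)); first exact: divr_gt0.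
move=> y; rewrite mx_norm_ball /ball_ /= ltr_pdivlMr// => xy.
apply: le_lt_trans (norm_le_eucl_dist _ _) _.
apply: le_lt_trans (Tc _ _) _; apply: le_lt_trans xy.
rewrite (le_trans (ler_wpM2l c0 (eucl_dist_le_norm _ _)))//.
by rewrite mulrA mulrDr mulr1 mulrC lerDl.
Qed.

(** Read in the parameter, [T] becomes [g \o T \o h], a continuous injection of the unit interval
    into the line, hence strictly monotone. *)
Lemma arc_map_monotone L h g (T : 'rV[R]_N -> 'rV[R]_N) :
  homeomorphism_on (`[0, 1] : set R) L h g -> continuous T -> injective T ->
  (forall x, L x -> L (T x)) ->
  (forall x y, L x -> L y -> (g (T x) <= g (T y)) = (g x <= g y)) \/
  (forall x y, L x -> L y -> (g (T x) <= g (T y)) = (g y <= g x)).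
Proof.
move=> [ch cg hK gK] cT iT LT.
have cf : {within `[0, 1], continuous (g \o T \o h)}.
  apply/subspace_continuousP => t It.
  have Lht : L (T (h t)) by apply: LT; case: (hK _ It).
  move/subspace_continuousP : cg => /(_ _ Lht) cg.
  move/subspace_continuousP : ch => /(_ _ It) ch.
  apply: cvg_comp cg => A nA.
  have nA' : nbhs (T (h t)) (fun y => L y -> A y) by [].
  have nT : \forall u \near t, `[0, 1]%classic u -> L (T (h u)) -> A (T (h u)).
    exact: (cvg_comp _ _ ch (cT (h t)) _ nA').
  change (\forall u \near t, `[0, 1]%classic u -> A (T (h u))).
  near=> u => Iu.
  have LThu : L (T (h u)) by apply: LT; case: (hK _ Iu).
  by move: Iu LThu; near: u.
have injf : {in `[0, 1] &, injective (g \o T \o h)}.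
  move=> t u It Iu /= E.
  have [Lt gt] := hK _ It; have [Lu gu] := hK _ Iu.
  rewrite -gt -gu; congr g; apply: iT.
  by have [_ <-] := gK _ (LT _ Lt); have [_ <-] := gK _ (LT _ Lu); rewrite E.
have [/le_mono_in mf|/le_nmono_in mf] := itv_continuous_inj_mono cf injf.
- left => x y Lx Ly; have [Ix xE] := gK _ Lx; have [Iy yE] := gK _ Ly.
  by have := mf _ _ Ix Iy; rewrite /= xE yE.
- right => x y Lx Ly; have [Ix xE] := gK _ Lx; have [Iy yE] := gK _ Ly.
  by have := mf _ _ Ix Iy; rewrite /= xE yE.
Unshelve. all: by end_near. Qed.

End ArcTopology.

(** Finitely many positive thresholds have a positive minimum. *)
Lemma uniform_pos_below (R : realType) (n : nat) (P : nat -> R -> Prop) :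
  (forall j a b, P j a -> 0 < b -> b <= a -> P j b) ->
  (forall j, (j < n)%N -> exists2 a, 0 < a & P j a) ->
  exists2 a, 0 < a & forall j, (j < n)%N -> P j a.
Proof.
move=> Panti; elim: n => [|n IH] Pn; first by exists 1.
have [a a0 Pa] := IH (fun j jn => Pn j (ltnW jn)).
have [b b0 Pb] := Pn n (ltnSn n).
have m0 : 0 < Num.min a b by rewrite lt_min a0.
exists (Num.min a b) => // j; rewrite ltnS leq_eqVlt => /predU1P[->|jn].
  by apply: Panti Pb _ _ => //; rewrite ge_min lexx orbT.
by apply: Panti (Pa j jn) _ _ => //; rewrite ge_min lexx.
Qed.

(** Unoriented version of [arc_itv]: a similitude may reverse the order of the arc, but it respects
    betweenness. *)
Definition arc_between (R : realType) (N : nat) (L : set 'rV[R]_N)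
    (g : 'rV[R]_N -> R) (x y : 'rV[R]_N) : set 'rV[R]_N :=
  [set w | [/\ L w, Num.min (g x) (g y) <= g w & g w <= Num.max (g x) (g y)]].

(** * Order of the arc: common ratio bound, vertices and pieces *)

Section SelfSimilarArc.
Variables (R : realType) (N l : nat) (S : nat -> 'rV[R]_N -> 'rV[R]_N).
Variables (L : set 'rV[R]_N) (s : R) (h : R -> 'rV[R]_N) (g : 'rV[R]_N -> R).
Variable z : nat -> 'rV[R]_N.
Hypothesis hL : self_similar_arc l S L.
Hypothesis s_gt0 : 0 < s.
Hypothesis hhomeo : homeomorphism_on (`[0, 1] : set R) L h g.
Hypothesis hz : arc_vertices l S L g z.

Local Notation d := eucl_dist.
Local Notation H := (hausdorff_measure s).
Local Notation between := (arc_between L g).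

Lemma arc_param_inj x y : L x -> L y -> g x = g y -> x = y.
Proof.
case: hhomeo => _ _ _ gK /gK[_ xE] /gK[_ yE] gxy.
by rewrite -xE gxy yE.
Qed.

Lemma arc_subset_map j x : (1 <= j <= l)%N -> L x -> L (S j x).
Proof. by move=> jl Lx; case: hL => -[_ _ _ ->] _ _ _; exists j => //; exists x. Qed.

Lemma arc_cover x : L x -> exists j, (1 <= j <= l)%N /\ (S j @` L) x.
Proof.
by have [[_ _ _ LE] _ _ _] := hL; rewrite {1}LE => -[j jl Sx]; exists j.
Qed.

Lemma arc_compact : compact L.
Proof. by case: hL => -[]. Qed.

Lemma similitude_ratios : exists2 t : R, 0 <= t < 1 &
  forall j, (1 <= j <= l)%N -> exists2 r, 0 < r <= t &
    forall x y, d (S j x) (S j y) = r * d x y.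
Proof.
have [|j|a a0 aP] := @uniform_pos_below R l.+1 (fun j a => (1 <= j <= l)%N ->
    exists2 r, 0 < r <= 1 - a & forall x y, d (S j x) (S j y) = r * d x y).
- move=> j a b Pa b0 ba /Pa[r /andP[r0 ra] rP]; exists r => //.
  by rewrite r0 (le_trans ra)// lerD2l lerN2.
- case: hL => -[simS _ _ _] _ _ _ _.
  have [jl|jl] := boolP (1 <= j <= l)%N; last by exists 1.
  have [r [r0 r1 rP]] := simS _ jl; exists (1 - r); first by rewrite subr_gt0.
  by move=> _; exists r => //; rewrite r0/=; lra.
- have aP' j : (1 <= j <= l)%N -> exists2 r, 0 < r <= 1 - a &
      forall x y, d (S j x) (S j y) = r * d x y.
    by move=> /[dup] /andP[_ jl]; apply: aP.
  (* If no index is in range, [a] may exceed 1; the maximum keeps the bound nonnegative. *)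
  exists (Num.max 0 (1 - a)).
    by rewrite le_max lexx gt_max ltr01/=; lra.
  move=> j /aP'[r /andP[r0 ra] rP]; exists r => //.
  by rewrite r0/= le_max ra orbT.
Qed.

Lemma le_arc_vertices i j : (i <= j)%N -> (j <= l)%N -> g (z i) <= g (z j).
Proof.
case: hz => _ zlt _; elim: j => [|j IH]; first by rewrite leqn0 => /eqP->.
rewrite leq_eqVlt => /predU1P[->//|ij] jl.
by rewrite (le_trans (IH ij (ltnW jl)))// ltW// (zlt j.+1).
Qed.

Lemma arc_vertex0_le x : L x -> g (z 0%N) <= g x.
Proof.
move=> /arc_cover[j [/andP[j1 jl]]]; case: hz => _ _ ->; last by rewrite j1.
case=> _ zx _; apply: le_trans zx; apply: le_arc_vertices => //.
by rewrite (leq_trans (leq_pred _)).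
Qed.

Lemma arc_le_vertexl x : L x -> g x <= g (z l).
Proof.
move=> /arc_cover[j [/andP[j1 jl]]]; case: hz => _ _ ->; last by rewrite j1.
by case=> _ _ xz; rewrite (le_trans xz)// le_arc_vertices.
Qed.

(** The strict inequality selects, when [x] is a vertex, the piece that ends at [x], so that the
    piece contains points preceding [x]. The mirror statement selects the piece that starts
    there. *)
Lemma arc_piece_left x : L x -> g (z 0%N) < g x ->
  exists2 j, (1 <= j <= l)%N & g (z j.-1) < g x <= g (z j).
Proof.
move=> Lx z0x; have := arc_le_vertexl Lx.
have : (l <= l)%N by [].
elim: {1 3}l => [|n IH] nl xz; first by rewrite leNgt z0x in xz.
have [xn|xn] := leP (g x) (g (z n)); first exact: IH (ltnW nl) xn.
by exists n.+1; rewrite //= xn.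
Qed.

Lemma arc_piece_right x : L x -> g x < g (z l) ->
  exists2 j, (1 <= j <= l)%N & g (z j.-1) <= g x < g (z j).
Proof.
move=> Lx; have : (l <= l)%N by [].
elim: {1 3}l => [|n IH] nl xz; first by rewrite ltNge arc_vertex0_le in xz.
have [xn|xn] := ltP (g x) (g (z n)); first exact: IH (ltnW nl) xn.
by exists n.+1; rewrite //= xn.
Qed.

Lemma arc_between_sym x y : between x y = between y x.
Proof. by rewrite /arc_between minC maxC. Qed.

Lemma arc_between_sub x y : between x y `<=` L.
Proof. by move=> w []. Qed.

Lemma arc_between_le x y : g x <= g y -> between x y = arc_itv L g x y.
Proof. by move=> xy; rewrite /arc_between min_l// max_r. Qed.

(** * Action of the similitudes on the order and on the measure of intervals *)

Lemma arc_maps_monotone j : (1 <= j <= l)%N ->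
  (forall x y, L x -> L y -> (g (S j x) <= g (S j y)) = (g x <= g y)) \/
  (forall x y, L x -> L y -> (g (S j x) <= g (S j y)) = (g y <= g x)).
Proof.
move=> jl; have [t _ /(_ _ jl)[r /andP[r0 _] rP]] := similitude_ratios.
apply: arc_map_monotone hhomeo _ _ _ => [|x y Sxy|x].
- by apply: (@eucl_lipschitz_continuous _ _ _ r) => [|x y]; rewrite ?rP// ltW.
- apply: eucl_dist_eq0; apply/eqP.
  have : d (S j x) (S j y) = 0 by rewrite Sxy eucl_distxx.
  by rewrite rP => /eqP; rewrite mulf_eq0 gt_eqF.
- exact: arc_subset_map.
Qed.

Lemma arc_between_map j x y w : (1 <= j <= l)%N -> L x -> L y -> L w ->
  between (S j x) (S j y) (S j w) <-> between x y w.
Proof.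
move=> jl Lx Ly Lw; rewrite /arc_between /= !ge_min !le_max.
have LSw := arc_subset_map jl Lw.
have [m|m] := arc_maps_monotone jl; rewrite !m//.
by split=> -[_ a b]; split.
by split=> -[_ a b]; split => //; rewrite orbC.
Qed.

Lemma arc_between_map_sub j x y : (1 <= j <= l)%N -> L x -> L y ->
  between (S j x) (S j y) `<=` S j @` between x y.
Proof.
move=> jl Lx Ly w Bw; have [_ _ piece] := hz.
have pieceS u : L u -> arc_itv L g (z j.-1) (z j) (S j u).
  by move=> Lu; rewrite -piece//; exists u.
have [[_ xl xr] [_ yl yr]] := (pieceS _ Lx, pieceS _ Ly).
have : (S j @` L) w.
  rewrite piece//; case: Bw => Lw wl wr; split => //.
    by apply: le_trans wl; rewrite le_min xl.
  by apply: (le_trans wr); rewrite ge_max xr.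
by case=> u Lu uw; exists u => //; apply/(arc_between_map jl Lx Ly Lu); rewrite uw.
Qed.

Lemma hausdorff_between_map j r x y : (1 <= j <= l)%N -> 0 < r ->
  (forall x y, d (S j x) (S j y) = r * d x y) -> L x -> L y ->
  (H (between (S j x) (S j y)) <= (r `^ s)%:E * H (between x y))%E.
Proof.
move=> jl r0 rP Lx Ly.
apply: (le_trans (le_hausdorff_measure s (arc_between_map_sub jl Lx Ly))).
rewrite -[X in (_ <= _ * H X)%E]image_id.
by apply: hausdorff_measure_scale => // [|u v _ _]; rewrite ?rP// ltW.
Qed.

(** * Rescaling a pair of points until no piece contains both *)

Lemma arc_dist_bounded : exists2 D : R, 0 < D & forall x y, L x -> L y -> d x y < D.
Proof.
have [M [_ /(_ (`|M| + 1)) MP]] := compact_bounded arc_compact.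
have {}MP x : L x -> `|x| <= `|M| + 1.
  by apply: MP; rewrite (le_lt_trans (ler_norm _))// ltrDl.
exists (Num.sqrt N%:R * (2 * (`|M| + 1)) + 1) => [|x y Lx Ly].
  by rewrite ltr_wpDl// !mulr_ge0// addr_ge0.
rewrite (le_lt_trans (eucl_dist_le_norm _ _))// ltr_pwDr// ler_wpM2l//.
rewrite (le_trans (ler_normB _ _))// mulr2n mulrDl mul1r.
by rewrite lerD ?MP.
Qed.

(* Undoing common similitudes stops, since each step enlarges the distance by a
   factor bounded away from 1. *)
Lemma arc_zoom x y : L x -> L y -> x <> y ->
  exists k x' y', [/\ 0 < k <= 1, L x' /\ L y', d x y = k * d x' y',
    (H (between x y) <= (k `^ s)%:E * H (between x' y'))%E &
    forall j, (1 <= j <= l)%N -> (S j @` L) x' -> (S j @` L) y' -> False].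
Proof.
move=> + + xy; have [t /andP[t0 t1] tP] := similitude_ratios.
have [D D0 DP] := arc_dist_bounded.
have [n nP] : exists n, D * t ^+ n < d x y.
  have dD : 0 < d x y / D by rewrite divr_gt0// eucl_dist_gt0.
  have : t ^+ n @[n --> \oo] --> 0 by apply: cvg_expr; rewrite ger0_norm.
  move=> /cvgrPdist_lt/(_ _ dD)[n _ /(_ n (leqnn n))].
  rewrite sub0r normrN ger0_norm ?exprn_ge0// ltr_pdivlMr// => tn.
  by exists n; rewrite mulrC.
(* [n] bounds the number of steps left: undoing one similitude removes a factor of at most [t], and
   at [n = 0] the distance would exceed the bound [D]. *)
elim: n x y {xy} nP => [|n IH] x y nP Lx Ly.
  by have := DP _ _ Lx Ly; rewrite ltNge ltW// -[D]mulr1.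
have [[j [jl [[x1 Lx1 x1E] [y1 Ly1 y1E]]]]|none] :=
    pselect (exists j, (1 <= j <= l)%N /\ ((S j @` L) x /\ (S j @` L) y));
  last first.
  exists 1, x, y; split => //; rewrite ?ltr01 ?lexx ?mul1r ?powR1 ?mul1e//.
  by move=> j jl Sx Sy; apply: none; exists j.
have [r /andP[r0 rt] rP] := tP _ jl.
have r1 : r <= 1 by rewrite (le_trans rt)// ltW.
have [|k [x' [y' [/andP[k0 k1] Lxy' dE HE none]]]] := IH x1 y1 _ Lx1 Ly1.
  rewrite -(ltr_pM2l r0) -rP x1E y1E (le_lt_trans _ nP)// exprS.
  by rewrite mulrCA ler_pM2l// ler_wpM2r// exprn_ge0.
exists (r * k), x', y'; split => //.
- by rewrite mulr_gt0//= mulr_ile1// ltW.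
- by rewrite -x1E -y1E rP dE mulrA.
rewrite powRM ?(ltW r0) ?(ltW k0)// EFinM -muleA -x1E -y1E.
apply: (le_trans (hausdorff_between_map jl r0 rP Lx1 Ly1)).
by apply: lee_wpmul2l => //; rewrite lee_fin powR_ge0.
Qed.

(** * Increments of [f] as measures of intervals, when the arc has finite measure *)

Section FiniteMeasure.
Hypothesis HLfin : (H L < +oo)%E.

Local Notation m x y := (fine (H (between x y))).
Local Notation f := (arc_measure s L g (z 0%N)).

Lemma hausdorff_fin_num A : A `<=` L -> H A \is a fin_num.
Proof.
move=> AL; rewrite ge0_fin_numE ?hausdorff_measure_ge0//.
exact: le_lt_trans (le_hausdorff_measure s AL) HLfin.
Qed.

Lemma arc_measure_fin_num x : f x \is a fin_num.
Proof. by apply: hausdorff_fin_num => w []. Qed.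

Lemma arc_measure_distC x y : (`|f x - f y| = `|f y - f x|)%E.
Proof.
have [fx fy] := (arc_measure_fin_num x, arc_measure_fin_num y).
by rewrite -(fineK fx) -(fineK fy) -!EFinB/= distrC.
Qed.

Lemma fine_between_ge0 x y : 0 <= m x y.
Proof. by rewrite fine_ge0// hausdorff_measure_ge0. Qed.

Lemma fine_between_le x y : m x y <= fine (H L).
Proof.
rewrite fine_le ?hausdorff_fin_num//; first exact: arc_between_sub.
by apply: le_hausdorff_measure; exact: arc_between_sub.
Qed.

Lemma fine_between_map j r x y : (1 <= j <= l)%N -> 0 < r ->
  (forall x y, d (S j x) (S j y) = r * d x y) -> L x -> L y ->
  m (S j x) (S j y) <= r `^ s * m x y.
Proof.
move=> jl r0 rP Lx Ly; have := hausdorff_between_map jl r0 rP Lx Ly.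
rewrite -[H (between x y)]fineK ?hausdorff_fin_num//; last exact: arc_between_sub.
rewrite -[H (between _ _)]fineK ?hausdorff_fin_num//; exact: arc_between_sub.
Qed.

Lemma arc_measure_dist_le x y : L x -> L y ->
  (`|f x - f y| <= (m x y)%:E)%E.
Proof.
wlog xy : x y / g x <= g y.
  move=> th Lx Ly; case: (leP (g x) (g y)) => [xy|/ltW yx]; first exact: th.
  by rewrite arc_measure_distC arc_between_sym; exact: th.
move=> Lx Ly.
have sub1 : arc_itv L g (z 0%N) x `<=` arc_itv L g (z 0%N) y.
  by move=> w [Lw zw wx]; split => //; exact: le_trans xy.
have sub2 : arc_itv L g (z 0%N) y `<=` arc_itv L g (z 0%N) x `|` between x y.
  move=> w [Lw zw wy]; have [wx|xw] := leP (g w) (g x); [left|right] => //.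
  by rewrite arc_between_le//; split => //; exact: ltW.
have fxy : (f x <= f y)%E := le_hausdorff_measure s sub1.
have fyx : (f y <= f x + H (between x y))%E.
  exact: le_trans (le_hausdorff_measure s sub2) (hausdorff_measureU _ _ _).
have Hm := hausdorff_fin_num (@arc_between_sub x y).
have [fx fy] := (arc_measure_fin_num x, arc_measure_fin_num y).
move: fxy fyx; rewrite -(fineK Hm) -(fineK fx) -(fineK fy).
rewrite -EFinD -EFinB !lee_fin /= => fxy fyx.
by rewrite distrC ger0_norm ?subr_ge0// lerBlDl.
Qed.

(* H^s has no atoms on L: a point is caught in cylinders of all generations,
   the measure of which decays geometrically. *)
Lemma arc_between_vanish (e : R) t v : 0 < e -> L t -> L v -> v <> t ->
  exists u, [/\ between v t u, u <> t & m u t < e].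
Proof.
move=> e0; have [c /andP[c0 c1] cP] := similitude_ratios.
set M := fine (H L).
have M0 : 0 <= M by rewrite fine_ge0// hausdorff_measure_ge0.
have cs1 : c `^ s < 1.
  by rewrite -[ltRHS](congr1 (@^~ s) (powR1 R)) gt0_ltr_powR// nnegrE.
have [n nP] : exists n, (c `^ s) ^+ n * M < e.
  have dD : 0 < e / (M + 1) by rewrite divr_gt0// ltr_wpDl.
  have : (c `^ s) ^+ n @[n --> \oo] --> 0.
    by apply: cvg_expr; rewrite ger0_norm ?powR_ge0.
  move=> /cvgrPdist_lt/(_ _ dD)[n _ /(_ n (leqnn n))].
  rewrite sub0r normrN ger0_norm ?exprn_ge0 ?powR_ge0//.
  rewrite ltr_pdivlMr ?ltr_wpDl// mulrDr mulr1 => tn; exists n.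
  by apply: le_lt_trans tn; rewrite lerDl exprn_ge0 ?powR_ge0.
(* [t'] and [v'] are general because the induction on the generation [k] replaces them by preimages
   in a piece. *)
suff main k t' v' : L t' -> L v' -> v' <> t' ->
    exists u, [/\ between v' t' u, u <> t' & m u t' <= (c `^ s) ^+ k * M].
  move=> Lt Lv vt; have [u [Bu ut mu]] := main n _ _ Lt Lv vt.
  by exists u; split => //; exact: le_lt_trans nP.
elim: k t' v' {t v nP} => [|k IH] t v Lt Lv vt.
  exists v; split => //; last by rewrite mul1r fine_between_le.
  by split; rewrite // ?ge_min ?le_max lexx.
have [_ _ piece] := hz.
(* The piece contains [t] and extends from it towards [v]; [w] is [v] if the piece reaches that far,
   and otherwise the end of the piece on that side. *)
have [j [w [jl Bw wt Sw St]]] : exists j w, [/\ (1 <= j <= l)%N,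
    between v t w, w <> t, (S j @` L) w & (S j @` L) t].
  have [vltt|tltv|vet] := ltgtP (g v) (g t); last 1 first.
  - by case: vt; exact: arc_param_inj.
  - have [|j jl /andP[zt tz]] := arc_piece_left Lt.
      exact: le_lt_trans (arc_vertex0_le Lv) vltt.
    exists j; exists (if g v <= g (z j.-1) then z j.-1 else v).
    have Lz : L (z j.-1).
      case: hz => + _ _; apply; case/andP: jl => _; exact: leq_trans (leq_pred _).
    have zz : g (z j.-1) <= g (z j) by apply: (le_trans (ltW zt)).
    rewrite piece// (arc_between_le (ltW vltt)).
    case: ifPn => [vz|]; last rewrite -ltNge => zv.
    - split => //; [|by move=> E; rewrite E ltxx in zt|].
      + by split => //; exact: ltW.
      + by split => //; exact: ltW.
    - split => //.
      + by split => //; exact: ltW.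
      + by split => //; [exact: ltW|exact: le_trans (ltW vltt) tz].
      + by split => //; exact: ltW.
  - have [|j jl /andP[zt tz]] := arc_piece_right Lt.
      exact: lt_le_trans tltv (arc_le_vertexl Lv).
    exists j; exists (if g (z j) <= g v then z j else v).
    have Lz : L (z j) by case: hz => + _ _; apply; case/andP: jl.
    have zz : g (z j.-1) <= g (z j) by apply: (le_trans zt); exact: ltW.
    rewrite piece// arc_between_sym (arc_between_le (ltW tltv)).
    case: ifPn => [vz|]; last rewrite -ltNge => zv.
    - split => //; [|by move=> E; rewrite E ltxx in tz|].
      + by split => //; exact: ltW.
      + by split => //; exact: ltW.
    - split => //.
      + by split => //; exact: ltW.
      + by split => //; [exact: le_trans zt (ltW tltv)|exact: ltW].
      + by split => //; exact: ltW.
case: Sw St => v1 Lv1 v1E [t1 Lt1 t1E].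
have [|u1 [Bu1 ut1 mu1]] := IH t1 v1 Lt1 Lv1.
  by move=> E; apply: wt; rewrite -v1E -t1E E.
have Lu1 := arc_between_sub Bu1.
have [r /andP[r0 rc] rP] := cP _ jl.
exists (S j u1); split.
- have /(arc_between_map jl Lv1 Lt1 Lu1) := Bu1; rewrite v1E t1E.
  case: Bw => _; rewrite !ge_min !le_max => w1 w2 [LSu].
  rewrite !ge_min !le_max => u2 u3; split => //; rewrite ?ge_min ?le_max; lra.
- rewrite -t1E => E; apply: ut1; apply: eucl_dist_eq0; apply/eqP.
  have : d (S j u1) (S j t1) = 0 by rewrite E eucl_distxx.
  by rewrite rP => /eqP; rewrite mulf_eq0 gt_eqF.
- rewrite -t1E (le_trans (fine_between_map jl r0 rP Lu1 Lt1))// exprS -mulrA.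
  rewrite ler_pM ?powR_ge0 ?fine_between_ge0//.
  by rewrite ge0_ler_powR ?nnegrE// ltW.
Qed.

(** The intervals up to [x] and from [x] to [y] touch, so additivity on separated sets does not
    apply directly. The second is started at [u] slightly after [x] instead, at a cost
    [m u x < e]. *)
Lemma arc_measure_dist_ge x y : L x -> L y -> x <> y ->
  ((m x y)%:E <= `|f x - f y|)%E.
Proof.
wlog xy : x y / g x <= g y.
  move=> th Lx Ly nxy; case: (leP (g x) (g y)) => [xy|/ltW yx]; first exact: th.
  by rewrite arc_measure_distC arc_between_sym; apply: th => // /esym.
move=> Lx Ly nxy.
have [fx fy] := (arc_measure_fin_num x, arc_measure_fin_num y).
rewrite -(fineK fx) -(fineK fy) -EFinB lee_fin.
suff main (e : R) : 0 < e -> m x y <= fine (f y) - fine (f x) + e.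
  rewrite distrC (le_trans _ (ler_norm _))//.
  by apply/ler_addgt0Pr => e e0; exact: main.
move=> e0; have [u [Bu ux mu]] := arc_between_vanish e0 Lx Ly (nesym nxy).
have Lu := arc_between_sub Bu.
have [_ gxu guy] : arc_itv L g x y u by rewrite -arc_between_le// arc_between_sym.
have {ux}gxu : g x < g u.
  rewrite lt_neqAle gxu andbT; apply/eqP => E; apply: ux.
  by apply: arc_param_inj.
(* Parameters before [x] and after [u] differ by at least [g u - g x], so the two intervals are at
   distance at least [dl]. *)
have [dl dl0 dlP] : exists2 dl, 0 < dl & forall a b, L a -> L b ->
    d a b < dl -> `|g a - g b| < g u - g x.
  case: hhomeo => _ cg _ _.
  by apply: (eucl_unif_continuous arc_compact cg); rewrite subr_gt0.
have Hsep : (f x + H (arc_itv L g u y) <= f y)%E.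
  apply: (le_trans (hausdorff_measure_separated s dl0 _)).
    move=> a b [La _ ax] [Lb ub _]; rewrite leNgt; apply/negP => /(dlP _ _ La Lb).
    rewrite ltNge => /negP; apply; rewrite distrC (le_trans _ (ler_norm _))//.
    by rewrite lerB.
  apply: le_hausdorff_measure => w [[Lw zw wx]|[Lw uw wy]]; split => //.
  - exact: le_trans xy.
  - exact: le_trans (arc_vertex0_le Lu) uw.
have Hsub : (H (between x y) <= H (between u x) + H (arc_itv L g u y))%E.
  apply: le_trans (hausdorff_measureU _ _ _); apply: le_hausdorff_measure => w.
  rewrite (arc_between_sym u) (arc_between_le xy) (arc_between_le (ltW gxu)).
  move=> -[Lw xw wy].
  have [wu|uw] := leP (g w) (g u); [left|right]; split => //; exact: ltW.
have F1 := hausdorff_fin_num (@arc_between_sub x y).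
have F2 := hausdorff_fin_num (@arc_between_sub u x).
have F3 : H (arc_itv L g u y) \is a fin_num.
  by apply: hausdorff_fin_num => w [].
have h1 : fine (f x) + fine (H (arc_itv L g u y)) <= fine (f y).
  by rewrite -lee_fin EFinD !fineK ?arc_measure_fin_num.
have h2 : m x y <= m u x + fine (H (arc_itv L g u y)).
  by rewrite -lee_fin EFinD !fineK.
lra.
Qed.

End FiniteMeasure.
End SelfSimilarArc.

(** * From adjacent pieces to all pairs of points *)

Theorem proposition4p2 (R : realType) (N l : nat)
    (S : nat -> 'rV[R]_N -> 'rV[R]_N) (L : set 'rV[R]_N) (s : R)
    (h : R -> 'rV[R]_N) (g : 'rV[R]_N -> R) (z : nat -> 'rV[R]_N)
    (hL : self_similar_arc l S L)
    (hdim : hausdorff_dim L = s%:E) (hs : 1 < s)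
    (hhomeo : homeomorphism_on (`[0, 1] : set R) L h g)
    (h0 : (S 1%N @` L) (h 0))
    (hz : arc_vertices l S L g z) :
  little_o_dist L (arc_measure s L g (z 0%N)) <->
  (forall p : nat, (1 <= p <= l.-1)%N ->
     condition_W L g z (arc_measure s L g (z 0%N)) p).
Proof.
split=> [lo p _ e e0|W].
  have [dl dl0 dlP] := lo e e0.
  by exists dl => // x y Lx Ly _ _ _ _; exact: dlP.
have s0 : 0 < s by exact: lt_trans hs.
have [ratio /andP[ratio0 ratio1] ratioP] := similitude_ratios hL.
have [_ zlt piece] := hz.
set f := arc_measure s L g (z 0%N).
(* With at most one piece, the rescaled images of the two distinct endpoints would still share it.
   Hence [W] can be used at [p = 1]. *)
have l2 : (2 <= l)%N.
  have [ch cg hK gK] := hhomeo.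
  have [Lh0 gh0] : L (h 0) /\ g (h 0) = 0.
    by apply: hK; rewrite /= in_itv/= lexx ler01.
  have [Lh1 gh1] : L (h 1) /\ g (h 1) = 1.
    by apply: hK; rewrite /= in_itv/= lexx ler01.
  have h01 : h 0 <> h 1.
    by move=> E; have := oner_neq0 R; rewrite -gh1 -E gh0 eqxx.
  have [k [x' [y' [_ [Lx' Ly'] _ _ none]]]] := arc_zoom hL s0 hhomeo hz Lh0 Lh1 h01.
  rewrite ltnNge; apply/negP => l1.
  have [i [il Sx]] := arc_cover hL Lx'; have [j [jl Sy]] := arc_cover hL Ly'.
  have ij : i = j by lia.
  by apply: (none i); rewrite // ij.
have Lfin : (hausdorff_measure s L < +oo)%E.
  have S1 : (1 <= 1 <= l)%N by rewrite (ltnW l2).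
  have [r /andP[r0 _] rP] := ratioP _ S1.
  (* If f (z 1) = +oo, then f (z 1) - f (z 1) = -oo violates W_1 at x = y = z 1. *)
  have fz1 : (f (z 1%N) < +oo)%E.
    have Lz1 : L (z 1%N) by case: hz => + _ _; apply; exact: ltnW.
    have [|mu mu0 muP] := W 1%N _ 1 ltr01; first by lia.
    have z01 : g (z 0%N) <= g (z 1%N) by rewrite ltW// (zlt 1%N).
    have z12 : g (z 1%N) <= g (z 2%N) by rewrite ltW// (zlt 2%N).
    have := muP _ _ Lz1 Lz1 z01 (lexx _) (lexx _) z12.
    by rewrite eucl_distxx mulr0 -/f ltey => /(_ mu0); case: eqVneq => // ->.
  have : (hausdorff_measure s (id @` L) <=
      (r^-1 `^ s)%:E * hausdorff_measure s (S 1%N @` L))%E.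
    apply: hausdorff_measure_scale; rewrite ?invr_gt0//; first exact: ltW.
    by move=> x y _ _; rewrite rP mulKf// gt_eqF.
  rewrite image_id piece// => /le_lt_trans; apply.
  by rewrite lte_mul_pinfty// lee_fin powR_ge0.
move=> e e0.
(* One threshold for all the conditions; index [p] here stands for Condition W at [p.+1]. *)
have [mu mu0 muP] : exists2 mu, 0 < mu & forall p, (p < l.-1)%N ->
    forall x y, L x -> L y ->
      g (z p) <= g x -> g x <= g (z p.+1) ->
      g (z p.+1) <= g y -> g y <= g (z p.+2) ->
      eucl_dist x y < mu ->
      (`|f x - f y| <= (e * eucl_dist x y)%:E)%E.
  apply: uniform_pos_below => [p a b Pa _ ba x y Lx Ly x1 x2 y1 y2 xy|p pl].
    by apply: Pa => //; exact: lt_le_trans ba.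
  by have [|mu mu0 muP] := W p.+1 _ e e0; [lia|exists mu].
(* Points with a whole piece between them are at distance at least [nu]. *)
have [nu nu0 nuP] : exists2 nu, 0 < nu & forall p, (p < l)%N ->
    forall x y, L x -> L y -> g x <= g (z p) -> g (z p.+1) <= g y ->
    nu <= eucl_dist x y.
  apply: uniform_pos_below => [p a b Pa _ ba x y Lx Ly x1 y1|p pl].
    by apply: (le_trans ba); exact: Pa.
  have [_ cg _ _] := hhomeo.
  have gap : 0 < g (z p.+1) - g (z p) by rewrite subr_gt0 (zlt p.+1).
  have [nu nu0 nuP] := eucl_unif_continuous (arc_compact hL) cg gap.
  exists nu => // x y Lx Ly xz zy; rewrite leNgt; apply/negP => /(nuP _ _ Lx Ly).
  by rewrite ltNge distrC (le_trans _ (ler_norm _))// lerB.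
pose c := Num.min mu nu.
have c0 : 0 < c by rewrite lt_min mu0.
have near_pair x y : L x -> L y -> g x <= g y -> eucl_dist x y < c ->
    (forall j, (1 <= j <= l)%N -> (S j @` L) x -> (S j @` L) y -> False) ->
    (`|f x - f y| <= (e * eucl_dist x y)%:E)%E.
  move=> Lx Ly xy; rewrite lt_min => /andP[xymu xynu] none.
  have [i [il Sx]] := arc_cover hL Lx; have [j [jl Sy]] := arc_cover hL Ly.
  have [_ x1 x2] : arc_itv L g (z i.-1) (z i) x by rewrite -piece.
  have [_ y1 y2] : arc_itv L g (z j.-1) (z j) y by rewrite -piece.
  have [ij|ji|ij] := ltngtP i j; last by case: (none i); rewrite // ij.
    (* Otherwise the piece [i.+1] would lie between [x] and [y], against the choice of [nu]. *)
    have ij1 : j = i.+1.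
      apply/eqP; rewrite eqn_leq ij andbT leqNgt; apply/negP => ij1.
      have [[_ jl'] ij2] := (andP jl, leq_trans ij (andP jl).2).
      have zij : g (z i.+1) <= g (z j.-1).
        by apply: (le_arc_vertices hz); clear -ij1 jl'; lia.
      by move: xynu; rewrite ltNge (nuP _ ij2 _ _ Lx Ly x2 (le_trans zij y1)).
    have iE : i.-1.+1 = i by case/andP: il => i0 _; rewrite prednK.
    have il' : (i.-1 < l.-1)%N by clear -iE ij1 jl; lia.
    rewrite ij1 /= in y1 y2.
    by apply: (muP _ il'); rewrite ?iE.
  (* If [j < i], then [y] follows [x] yet precedes the end of piece [i], so piece [i] contains
     both. *)
  case: (none i) => //; rewrite piece//; split => //.
    exact: le_trans x1 xy.
  apply: (le_trans y2); apply: (le_arc_vertices hz); first exact: ltnW.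
  by case/andP: il.
set M := fine (hausdorff_measure s L).
have M0 : 0 <= M by rewrite fine_ge0// hausdorff_measure_ge0.
have s1 : 0 < s - 1 by rewrite subr_gt0.
have q0 : 0 < e * c / (M + 1) by rewrite divr_gt0 ?mulr_gt0// ltr_wpDl.
have powS (k : R) : 0 < k -> k `^ s = k * k `^ (s - 1).
  move=> k0; rewrite -{2}[k]powRr1 ?(ltW k0)// -powRD ?(gt_eqF k0) ?implybT//.
  by congr (_ `^ _); ring.
pose m x y := fine (hausdorff_measure s (arc_between L g x y)).
exists (c * (e * c / (M + 1)) `^ (s - 1)^-1); first by rewrite mulr_gt0// powR_gt0.
move=> x y Lx Ly xyd.
have [<-|xy] := pselect (x = y).
  by rewrite eucl_distxx mulr0 subee ?abse0// (arc_measure_fin_num _ _ Lfin).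
apply: le_trans (arc_measure_dist_le g z Lfin Lx Ly) _; rewrite lee_fin.
have [k [x' [y' [/andP[k0 k1] [Lx' Ly'] dE HE none]]]] :=
  arc_zoom hL s0 hhomeo hz Lx Ly xy.
have mE : m x y <= k `^ s * m x' y'.
  rewrite -lee_fin EFinM !fineK//; apply: (hausdorff_fin_num Lfin);
  exact: arc_between_sub.
apply: (le_trans mE).
have kP : 0 <= k `^ (s - 1) by exact: powR_ge0.
have m0 : 0 <= m x' y' by rewrite fine_ge0// hausdorff_measure_ge0.
have d0 := eucl_dist_ge0 x' y'.
rewrite powS// dE.
have [dc|cd] := ltP (eucl_dist x' y') c.
  have xy' : x' <> y' by move=> E; apply: xy; apply: eucl_dist_eq0;
    rewrite dE E eucl_distxx mulr0.
  have mle : m x' y' <= e * eucl_dist x' y'.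
    rewrite -lee_fin.
    apply: (le_trans (arc_measure_dist_ge hL s0 hhomeo hz Lfin Lx' Ly' xy')).
    have [gxy|/ltW gyx] := leP (g x') (g y'); first exact: near_pair.
    rewrite (arc_measure_distC _ _ Lfin) eucl_dist_sym.
    apply: near_pair => //; first by rewrite eucl_dist_sym.
    by move=> j jl Sy Sx; exact: (none j).
  have k1' : k `^ (s - 1) <= 1.
    by rewrite -[leRHS](congr1 (@^~ (s - 1)) (powR1 R)) ge0_ler_powR ?nnegrE// ltW.
  rewrite mulrCA -mulrA ler_pM2l// (le_trans _ mle)//.
  by rewrite ler_piMl.
have mle : m x' y' <= M by exact: fine_between_le.
have kc : k `^ (s - 1) <= e * c / (M + 1).
  have -> : e * c / (M + 1) = ((e * c / (M + 1)) `^ (s - 1)^-1) `^ (s - 1).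
    by rewrite -powRrM mulVf ?gt_eqF// powRr1// ltW.
  rewrite ge0_ler_powR ?nnegrE ?powR_ge0 ?(ltW s1) ?(ltW k0)//.
  rewrite -(ler_pM2l c0) (le_trans _ (ltW xyd))// dE mulrC.
  by rewrite ler_pM2l.
rewrite mulrCA -mulrA ler_pM2l//.
apply: (@le_trans _ _ (e * c / (M + 1) * M)); first exact: ler_pM.
apply: (@le_trans _ _ (e * c)); last by rewrite ler_pM2l.
rewrite -mulrA ger_pMr ?mulr_gt0// mulrC ler_pdivrMr ?ltr_wpDl//.
by rewrite mul1r lerDl.
Qed.
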